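(* Let $n\ge1$, $\sigma_1,\sigma_2>0$, $L>0$, let $x_1^*\neq x_2^*$ be points of $\mathbb{R}^n$ and let $\mathcal C\subset\mathbb{R}^n$ be a compact convex set containing $x_1^*$ and $x_2^*$. With the sets $\mathcal N,\hat{\mathcal N},\hat{\mathcal M},\mathcal I,\mathcal I_1,\mathcal I_2$ defined in the context, $$\mathcal N(x_1^*,x_2^* )\subseteq\hat{\mathcal N}(x_1^*,x_2^* )\subseteq\mathcal I(x_1^*,x_2^* ),\qquad \mathcal I(x_1^*,x_2^* )=\mathcal I_1(x_1^* )\cap\mathcal I_2(x_2^* ),\qquad \hat{\mathcal N}(x_1^*,x_2^* )\subseteq\hat{\mathcal M}(x_1^*,x_2^* ).$$
   Context: $\|\cdot\|$ is the Euclidean norm and $\angle(u,v)=\arccos\big(\frac{u^Tv}{\|u\|\|v\|}\big)$ for nonzero $u,v$. A differentiable $f:\mathbb{R}^n\to\mathbb{R}$ is $\sigma$-strongly convex ($\sigma>0$) if $(\nabla f(x)-\nabla f(y))^T(x-y)\ge\sigma\|x-y\|^2$ for all $x,y$; $\mathcal S(\sigma)$ is the set of all such functions. $\mathcal F(\sigma,L,\mathcal C)=\{f\in\mathcal S(\sigma):\|\nabla f(x)\|\le L\ \forall x\in\mathcal C\}$. $\mathcal N(x_1^*,x_2^* )$ is the set of $x\in\mathcal C$ for which there exist $f_1\in\mathcal F(\sigma_1,L,\mathcal C)$, $f_2\in\mathcal F(\sigma_2,L,\mathcal C)$ with $\nabla f_1(x_1^* )=0$, $\nabla f_2(x_2^*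 )=0$ and $\nabla f_1(x)=-\nabla f_2(x)$. For $x\in\mathcal C$ let $d(x,\partial\mathcal C)=\inf_{y\in\partial\mathcal C}\|y-x\|$, where $\partial\mathcal C$ is the topological boundary of $\mathcal C$ in $\mathbb{R}^n$, and $\tilde L(x)=L-\min(\sigma_1,\sigma_2)\,d(x,\partial\mathcal C)$. For $\ell>0$ and $x$ with $\frac{\sigma_i}\ell\|x-x_i^*\|\le1$ put $\tilde\phi_i(x,\ell)=\arccos\big(\frac{\sigma_i}\ell\|x-x_i^*\|\big)$, $i=1,2$; $\tilde\phi_i(x,\tilde L)$ means $\tilde\phi_i(x,\tilde L(x))$. For $x\notin\{x_1^*,x_2^*\}$ put $\alpha_i(x)=\angle(x-x_i^*,x_2^*-x_1^* )$ and $\psi(x)=\pi-(\alpha_2(x)-\alpha_1(x))$. Define $$\hat{\mathcal M}(x_1^*,x_2^* )=\Big\{x\in\mathbb{R}^n:\ \tilde\phi_1(x,L)+\tilde\phi_2(x,L)\ge\psi(x),\ \|x-x_1^*\|\le\tfrac L{\sigma_1},\ \|x-x_2^*\|\le\tfrac L{\sigma_2}\Big\},$$ $$\hat{\mathcal N}(x_1^*,x_2^* )=\Big\{x\in\mathcal C:\ \tilde\phi_1(x,\tilde L)+\tilde\phi_2(x,\tilde L)\ge\psi(x),\ \|x-x_1^*\|\le\tfrac1{\sigma_1}\tilde L(x),\ \|x-x_2^*\|\le\tfrac1{\sigma_2}\tilde L(x)\Big\},$$ where the points $x_1^*,x_2^*$, at which $\psi$ is undefined, are regarded as not belonging to either set.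 $\mathcal I(x_1^*,x_2^* )$ is the set of $x\in\mathcal C$ for which there exist $f_1\in\mathcal S(\sigma_1)$, $f_2\in\mathcal S(\sigma_2)$ with $\nabla f_1(x_1^* )=0$, $\nabla f_2(x_2^* )=0$, $\|\nabla f_1(x)\|\le\tilde L(x)$, $\|\nabla f_2(x)\|\le\tilde L(x)$. For $i=1,2$, $\mathcal I_i(x_i^* )$ is the set of $x\in\mathcal C$ for which there exists $f_i\in\mathcal S(\sigma_i)$ with $\nabla f_i(x_i^* )=0$ and $\|\nabla f_i(x)\|\le\tilde L(x)$. *)

(* Defs.v *)
From HB Require Import structures.
From mathcomp Require Import all_boot all_order all_algebra.
From mathcomp Require Import all_classical all_reals all_analysis.

Set Implicit Arguments.
Unset Strict Implicit.
Unset Printing Implicit Defensive.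

Import Order.TTheory GRing.Theory Num.Theory.
Import numFieldNormedType.Exports.

Local Open Scope classical_set_scope.
Local Open Scope ring_scope.

(* Points of R^n are row vectors 'rV[R]_n. The norm `|x| of 'rV[R]_n is the
   sup norm, so the Euclidean norm is a separate definition; the topology of
   'rV[R]_n and the predicate [differentiable] are those of the Euclidean norm,
   all norms on R^n being equivalent. *)

Definition dot (R : realType) (n : nat) (u v : 'rV[R]_n) : R :=
  \sum_(i < n) u 0 i * v 0 i.

Definition enorm (R : realType) (n : nat) (u : 'rV[R]_n) : R :=
  Num.sqrt (dot u u).

(* Only meaningful for nonzero [u] and [v]. *)
Definition angle (R : realType) (n : nat) (u v : 'rV[R]_n) : R :=
  acos (dot u v / (enorm u * enorm v)).

Definition gradient (R : realType) (n : nat) (f : 'rV[R]_n -> R)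
    (x : 'rV[R]_n) : 'rV[R]_n :=
  \row_(j < n) 'D_(delta_mx 0 j) f x.

Definition strongly_convex (R : realType) (n : nat) (sigma : R) :
    set ('rV[R]_n -> R) :=
  [set f | (forall x, differentiable f x) /\
     (forall x y, sigma * enorm (x - y) ^+ 2
                  <= dot (gradient f x - gradient f y) (x - y))].

Definition strongly_convex_bounded (R : realType) (n : nat) (sigma L : R)
    (C : set 'rV[R]_n) : set ('rV[R]_n -> R) :=
  [set f | strongly_convex sigma f /\
     (forall x, C x -> enorm (gradient f x) <= L)].

Definition boundary (T : topologicalType) (A : set T) : set T :=
  closure A `\` A°.

Definition dist_boundary (R : realType) (n : nat) (C : set 'rV[R]_n)
    (x : 'rV[R]_n) : R :=
  inf [set enorm (y - x) | y in boundary C].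

Definition Ltilde (R : realType) (n : nat) (sigma1 sigma2 L : R)
    (C : set 'rV[R]_n) (x : 'rV[R]_n) : R :=
  L - Num.min sigma1 sigma2 * dist_boundary C x.

(* Only meaningful when 0 < l and sigma / l * enorm (x - xs) <= 1. *)
Definition phi_tilde (R : realType) (n : nat) (sigma : R) (xs x : 'rV[R]_n)
    (l : R) : R :=
  acos (sigma / l * enorm (x - xs)).

Definition alpha (R : realType) (n : nat) (x1 x2 xs x : 'rV[R]_n) : R :=
  angle (x - xs) (x2 - x1).

Definition psi (R : realType) (n : nat) (x1 x2 x : 'rV[R]_n) : R :=
  pi - (alpha x1 x2 x2 x - alpha x1 x2 x1 x).

Definition N_set (R : realType) (n : nat) (sigma1 sigma2 L : R)
    (C : set 'rV[R]_n) (x1 x2 : 'rV[R]_n) : set 'rV[R]_n :=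
  [set x | C x /\ exists f1 f2 : 'rV[R]_n -> R,
     [/\ strongly_convex_bounded sigma1 L C f1,
         strongly_convex_bounded sigma2 L C f2,
         gradient f1 x1 = 0,
         gradient f2 x2 = 0 &
         gradient f1 x = - gradient f2 x]].

Definition M_hat (R : realType) (n : nat) (sigma1 sigma2 L : R)
    (x1 x2 : 'rV[R]_n) : set 'rV[R]_n :=
  [set x | [/\ x <> x1, x <> x2,
     psi x1 x2 x <= phi_tilde sigma1 x1 x L + phi_tilde sigma2 x2 x L,
     enorm (x - x1) <= L / sigma1 &
     enorm (x - x2) <= L / sigma2]].

(* [Ltilde] need not be positive on C, but for positive sigma1 the bound on
   enorm (x - x1), together with x <> x1, makes it positive on this set, so
   both angles [phi_tilde] below are meaningful at every member. *)
Definition N_hat (R : realType) (n : nat) (sigma1 sigma2 L : R)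
    (C : set 'rV[R]_n) (x1 x2 : 'rV[R]_n) : set 'rV[R]_n :=
  [set x | C x /\
    let l := Ltilde sigma1 sigma2 L C x in
    [/\ x <> x1, x <> x2,
     psi x1 x2 x <= phi_tilde sigma1 x1 x l + phi_tilde sigma2 x2 x l,
     enorm (x - x1) <= 1 / sigma1 * l &
     enorm (x - x2) <= 1 / sigma2 * l]].

Definition I_set (R : realType) (n : nat) (sigma1 sigma2 L : R)
    (C : set 'rV[R]_n) (x1 x2 : 'rV[R]_n) : set 'rV[R]_n :=
  [set x | C x /\ exists f1 f2 : 'rV[R]_n -> R,
     [/\ strongly_convex sigma1 f1 /\ strongly_convex sigma2 f2,
         gradient f1 x1 = 0,
         gradient f2 x2 = 0,
         enorm (gradient f1 x) <= Ltilde sigma1 sigma2 L C x &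
         enorm (gradient f2 x) <= Ltilde sigma1 sigma2 L C x]].

(* The set I_i(x_i^* ) is [I_single sigma1 sigma2 L C sigma_i x_i]: both
   parameters sigma1 and sigma2 enter through [Ltilde]. *)
Definition I_single (R : realType) (n : nat) (sigma1 sigma2 L : R)
    (C : set 'rV[R]_n) (sigma : R) (xs : 'rV[R]_n) : set 'rV[R]_n :=
  [set x | C x /\ exists f : 'rV[R]_n -> R,
     [/\ strongly_convex sigma f,
         gradient f xs = 0 &
         enorm (gradient f x) <= Ltilde sigma1 sigma2 L C x]].

(* Main.v *)
Require Import Defs.
From HB Require Import structures.
From mathcomp Require Import all_boot all_order all_algebra.
From mathcomp Require Import all_classical all_reals all_analysis.
From mathcomp Require Import ring lra.

Set Implicit Arguments.
Unset Strict Implicit.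
Unset Printing Implicit Defensive.

Import Order.TTheory GRing.Theory Num.Theory.
Import numFieldNormedType.Exports.

Local Open Scope classical_set_scope.
Local Open Scope ring_scope.

(** The first inclusion carries the content. Let [x] be in [N_set], with
    functions [f1], [f2], and put [g = gradient f1 x = - gradient f2 x].

    The norm of [g] is at most [Ltilde x], not just [L]: following the direction
    of the gradient of [f_i] from [x] to the boundary of [C], strong convexity
    makes the norm of the gradient grow by at least [sigma_i] times the distance
    covered, and at the end it is still at most [L]
    ([gradient_le_dist_boundary]).

    Strong convexity between [x] and the minimizer [x_i] bounds the inner product
    of [gradient f_i x] and [x - x_i] below by [sigma_i] times the squared norm
    of [x - x_i]. With Cauchy-Schwarz this gives the two bounds on the distances
    ([gradient_lower_bound]), and it says that [gradient f_i x] makes with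
    [x - x_i] an angle of at most [phi_tilde_i] ([angle_gradient_le]). Since the
    gradients are opposite, [g] is within [phi_tilde_1] of [x - x1] and within
    [phi_tilde_2] of [x2 - x], so the angle of [x - x1] and [x2 - x] is at most
    [phi_tilde_1 + phi_tilde_2] by the triangle inequality for angles
    ([angle_triangle]). As the angles of a triangle add up to [pi], that angle
    is [psi x] ([psi_le], by way of [angle_cone]).

    The inclusion in [I_set] is witnessed by the quadratic functions
    [sigma_i / 2 * |x - x_i| ^ 2], whose gradients have norm
    [sigma_i * |x - x_i|]. The two functions of [I_set] are chosen independently
    of each other, which gives the equality. Finally, [Ltilde <= L], and
    [phi_tilde] increases with its last argument. *)

(** * Euclidean inner product and angles *)

Section Euclid.
Context {R : realType} {n : nat}.
Implicit Types u v w : 'rV[R]_n.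

Lemma dotC u v : dot u v = dot v u.
Proof. by apply: eq_bigr => i _; rewrite mulrC. Qed.

Lemma dotDl u v w : dot (u + v) w = dot u w + dot v w.
Proof.
by rewrite /dot -big_split; apply: eq_bigr => i _; rewrite mxE mulrDl.
Qed.

Lemma dotZl (a : R) u v : dot (a *: u) v = a * dot u v.
Proof.
by rewrite /dot mulr_sumr; apply: eq_bigr => i _; rewrite mxE mulrA.
Qed.

Lemma dotNl u v : dot (- u) v = - dot u v.
Proof. by rewrite -scaleN1r dotZl mulN1r. Qed.

Lemma dotBl u v w : dot (u - v) w = dot u w - dot v w.
Proof. by rewrite dotDl dotNl. Qed.

Lemma dotDr u v w : dot u (v + w) = dot u v + dot u w.
Proof. by rewrite dotC dotDl !(dotC u). Qed.

Lemma dotZr (a : R) u v : dot u (a *: v) = a * dot u v.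
Proof. by rewrite dotC dotZl dotC. Qed.

Lemma dotNr u v : dot u (- v) = - dot u v.
Proof. by rewrite dotC dotNl dotC. Qed.

Lemma dotBr u v w : dot u (v - w) = dot u v - dot u w.
Proof. by rewrite dotDr dotNr. Qed.

Lemma dotuu_ge0 u : 0 <= dot u u.
Proof. by apply: sumr_ge0 => i _; rewrite -expr2 sqr_ge0. Qed.

Lemma dotuu_eq0 u : dot u u = 0 -> u = 0.
Proof.
move=> /eqP; rewrite psumr_eq0 => [/allP u0|i _]; last by rewrite -expr2 sqr_ge0.
apply/rowP => i; rewrite mxE; apply/eqP.
by have := u0 i (mem_index_enum i); rewrite /= -expr2 sqrf_eq0.
Qed.

Lemma enorm_ge0 u : 0 <= enorm u.
Proof. exact: sqrtr_ge0. Qed.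

Lemma sqr_enorm u : enorm u ^+ 2 = dot u u.
Proof. by rewrite sqr_sqrtr // dotuu_ge0. Qed.

Lemma enorm_gt0 u : u <> 0 -> 0 < enorm u.
Proof.
move=> u0; rewrite lt_neqAle enorm_ge0 andbT eq_sym.
by apply/eqP => h; apply: u0; apply: dotuu_eq0; rewrite -sqr_enorm h expr0n.
Qed.

Lemma enormN u : enorm (- u) = enorm u.
Proof. by rewrite /enorm dotNl dotNr opprK. Qed.

Lemma enormZ (a : R) u : enorm (a *: u) = `|a| * enorm u.
Proof.
by rewrite /enorm dotZl dotZr mulrA -expr2 sqrtrM ?sqr_ge0 // sqrtr_sqr.
Qed.

(** The right-hand side minus the left-hand side, multiplied by [dot v v], is
    the squared norm of [dot v v *: u - dot u v *: v]. *)
Lemma dot_sqr_le u v : dot u v ^+ 2 <= dot u u * dot v v.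
Proof.
have [v0|v0] := eqVneq (dot v v) 0.
  have -> : v = 0 *: (0 : 'rV[R]_n) by rewrite scale0r; exact: dotuu_eq0.
  by rewrite !dotZr !mul0r mulr0 expr0n.
have vp : 0 < dot v v by rewrite lt_neqAle eq_sym v0 dotuu_ge0.
have := dotuu_ge0 (dot v v *: u - dot u v *: v).
rewrite !(dotBl, dotBr, dotZl, dotZr) (dotC v u) => h.
rewrite -subr_ge0 -(pmulr_rge0 _ vp).
by apply: le_trans h _; rewrite le_eqVlt; apply/orP; left; apply/eqP; ring.
Qed.

Lemma cauchy_schwarz u v : `|dot u v| <= enorm u * enorm v.
Proof.
rewrite -(@ler_pXn2r _ 2) ?nnegrE ?normr_ge0 ?mulr_ge0 ?enorm_ge0 //.
by rewrite real_normK ?num_real // exprMn !sqr_enorm dot_sqr_le.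
Qed.

Lemma dot_le_enorm u v : dot u v <= enorm u * enorm v.
Proof. exact: le_trans (ler_norm _) (cauchy_schwarz u v). Qed.

Lemma cos_arg_itv u v : u <> 0 -> v <> 0 ->
  -1 <= dot u v / (enorm u * enorm v) <= 1.
Proof.
move=> u0 v0; have p : 0 < enorm u * enorm v by rewrite mulr_gt0 ?enorm_gt0.
rewrite -ler_norml normrM normfV [X in _ / X]gtr0_norm //.
by rewrite ler_pdivrMr // mul1r cauchy_schwarz.
Qed.

Lemma angle_ge0 u v : u <> 0 -> v <> 0 -> 0 <= angle u v.
Proof. by move=> u0 v0; exact/acos_ge0/cos_arg_itv. Qed.

Lemma angle_lepi u v : u <> 0 -> v <> 0 -> angle u v <= pi.
Proof. by move=> u0 v0; exact/acos_lepi/cos_arg_itv. Qed.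

Lemma cos_angle u v : u <> 0 -> v <> 0 ->
  cos (angle u v) = dot u v / (enorm u * enorm v).
Proof. by move=> u0 v0; rewrite /angle acosK // in_itv /= cos_arg_itv. Qed.

Lemma sin_angle u v : u <> 0 -> v <> 0 ->
  sin (angle u v) =
    Num.sqrt (dot u u * dot v v - dot u v ^+ 2) / (enorm u * enorm v).
Proof.
move=> u0 v0; have p : 0 < enorm u * enorm v by rewrite mulr_gt0 ?enorm_gt0.
rewrite /angle sin_acos ?cos_arg_itv // -!sqr_enorm.
move: p; set q := enorm u * enorm v => p.
have -> : enorm u ^+ 2 * enorm v ^+ 2 - dot u v ^+ 2 =
    q ^+ 2 * (1 - (dot u v / q) ^+ 2).
  by rewrite -exprMn -/q; field; rewrite gt_eqF.
by rewrite sqrtrM ?sqr_ge0 // sqrtr_sqr gtr0_norm // [q * _]mulrC mulfK // gt_eqF.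
Qed.

Lemma angleC u v : angle u v = angle v u.
Proof. by rewrite /angle dotC (mulrC (enorm u)). Qed.

Lemma angleNl u v : u <> 0 -> v <> 0 -> angle (- u) v = pi - angle u v.
Proof.
by move=> u0 v0; rewrite /angle dotNl enormN mulNr acosN // cos_arg_itv.
Qed.

Lemma angleNN u v : angle (- u) (- v) = angle u v.
Proof. by rewrite /angle dotNl dotNr opprK !enormN. Qed.

End Euclid.

Lemma le_cos {R : realType} (x y : R) : 0 <= x <= pi -> 0 <= y <= pi ->
  (cos y <= cos x) = (x <= y).
Proof. by move=> hx hy; rewrite !leNgt ltr_cos // in_itv. Qed.

Lemma acos_le {R : realType} (x y : R) : -1 <= x -> x <= y -> y <= 1 ->
  acos y <= acos x.
Proof.
move=> x1 xy y1.
have hx : -1 <= x <= 1 by rewrite x1 (le_trans xy).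
have hy : -1 <= y <= 1 by rewrite y1 (le_trans x1).
by rewrite -le_cos ?acos_ge0 ?acos_lepi // !acosK // in_itv.
Qed.

(** * Triangle inequality for angles and its equality case *)

Section Angles.
Context {R : realType} {n : nat}.
Implicit Types u v w a b : 'rV[R]_n.

(** If the two angles on the right add up to at least [pi] there is nothing to
    prove. Otherwise the cosine can be compared: by the addition formula the
    claim is the Cauchy-Schwarz inequality for the components of [u] and [v]
    orthogonal to [w]. *)
Lemma angle_triangle u v w : u <> 0 -> v <> 0 -> w <> 0 ->
  angle u v <= angle u w + angle w v.
Proof.
move=> u0 v0 w0.
have [|hpi] := leP pi (angle u w + angle w v).
  by apply: le_trans; exact: angle_lepi.
rewrite -le_cos ?angle_ge0 ?angle_lepi ?addr_ge0 ?angle_ge0 ?(ltW hpi) //.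
rewrite cosD !cos_angle // !sin_angle //.
have pu := enorm_gt0 u0; have pv := enorm_gt0 v0; have pw := enorm_gt0 w0.
have := cauchy_schwarz (dot w w *: u - dot u w *: w) (dot w w *: v - dot w v *: w).
(* The orthogonal components are scaled by [dot w w] to avoid divisions; the
   norm of one of them is then a multiple of the sine of its angle with [w]. *)
have e z : enorm (dot w w *: z - dot z w *: w) =
    enorm w * Num.sqrt (dot z z * dot w w - dot z w ^+ 2).
  rewrite -sqrtrM ?dotuu_ge0 // /enorm; congr Num.sqrt.
  by rewrite !(dotBl, dotBr, dotZl, dotZr) (dotC w z); ring.
rewrite (dotC w v) !e ler_norml => /andP[+ _].
rewrite !(dotBl, dotBr, dotZl, dotZr) (dotC w v) (mulrC (dot v v)).
set S := Num.sqrt _; set T := Num.sqrt _ => h.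
have {}h : dot u w * dot v w - S * T <= dot w w * dot u v.
  rewrite -(ler_pM2l (exprn_gt0 2 pw)) sqr_enorm; move: h; rewrite -sqr_enorm; nra.
have -> : dot u v / (enorm u * enorm v) =
   (dot w w * dot u v) / (enorm w ^+ 2 * (enorm u * enorm v)).
  by rewrite -sqr_enorm; field; rewrite !gt_eqF.
have -> : dot u w / (enorm u * enorm w) * (dot v w / (enorm w * enorm v)) -
    S / (enorm u * enorm w) * (T / (enorm w * enorm v)) =
   (dot u w * dot v w - S * T) / (enorm w ^+ 2 * (enorm u * enorm v)).
  by field; rewrite !gt_eqF.
by rewrite ler_pM2r // invr_gt0 !mulr_gt0.
Qed.

(** The inequality opposite to [angle_triangle] when the intermediate vector is
    in the cone of the other two: the sine terms of the addition formula are
    square roots of Gram determinants, and these determinants all agree because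
    adding [a] to [b] does not change the area of the parallelogram that they
    span. Hence the cosines of both sides are equal. *)
Lemma angle_cone a b : a <> 0 -> b <> 0 -> a + b <> 0 ->
  angle a (a + b) + angle (a + b) b <= angle a b.
Proof.
move=> a0 b0 c0; set c := a + b.
have pa := enorm_gt0 a0; have pb := enorm_gt0 b0; have pc := enorm_gt0 c0.
have ha := sqr_enorm a; have hb := sqr_enorm b.
have hc : enorm c ^+ 2 = dot a a + 2 * dot a b + dot b b.
  by rewrite sqr_enorm !(dotDl, dotDr) (dotC b a); ring.
have hac : dot a c = dot a a + dot a b by rewrite dotDr.
have hcb : dot c b = dot a b + dot b b by rewrite dotDl.
have hab : 0 <= enorm a * enorm b + dot a b.
  by have := cauchy_schwarz a b; rewrite ler_norml -lerBlDl sub0r => /andP[].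
(* The cosines determine the angles only once the sum is known to lie in
   [0, pi]. *)
have hs : angle a c + angle c b <= pi.
  rewrite -lerBrDr -le_cos; first last.
  - by rewrite subr_ge0 angle_lepi //= lerBlDr lerDl angle_ge0.
  - by rewrite angle_ge0 ?angle_lepi.
  rewrite addrC cosDpi cosN !cos_angle // hac hcb.
  rewrite -subr_ge0 opprK.
  have -> : (dot a a + dot a b) / (enorm a * enorm c) +
     (dot a b + dot b b) / (enorm c * enorm b) =
     (enorm a + enorm b) * (enorm a * enorm b + dot a b)
      / (enorm a * enorm b * enorm c).
    by rewrite -ha -hb; field; rewrite !gt_eqF.
  by rewrite divr_ge0 ?(mulr_ge0 _ hab) ?ltW ?addr_gt0 ?mulr_gt0.
rewrite -le_cos ?angle_ge0 ?angle_lepi ?addr_ge0 ?angle_ge0 //.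
rewrite cosD !cos_angle // !sin_angle //.
have -> : dot c c * dot b b - dot c b ^+ 2 = dot a a * dot c c - dot a c ^+ 2.
  by rewrite -sqr_enorm hc hac hcb; ring.
set G := Num.sqrt _.
have hG : G ^+ 2 = dot a a * dot c c - dot a c ^+ 2.
  by rewrite sqr_sqrtr // subr_ge0 dot_sqr_le.
have -> : dot a c / (enorm a * enorm c) * (dot c b / (enorm c * enorm b)) -
   G / (enorm a * enorm c) * (G / (enorm c * enorm b)) =
   (dot a c * dot c b - G ^+ 2) / (enorm c ^+ 2 * (enorm a * enorm b)).
  by field; rewrite !gt_eqF.
have -> : dot a c * dot c b - G ^+ 2 = enorm c ^+ 2 * dot a b.
  by rewrite hG -(sqr_enorm c) hc hac hcb; ring.
by rewrite -mulf_div divff ?mul1r // expf_neq0 // gt_eqF.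
Qed.

End Angles.

(** * Distance to the boundary *)

Section Boundary.
Context {R : realType} {n : nat}.
Implicit Types (x u : 'rV[R]_n) (C : set 'rV[R]_n).

Lemma ray_continuous x u : continuous (fun t : R => x + t *: u).
Proof.
by move=> t; apply: cvgD; [exact: cvg_cst | apply: cvgZr_tmp; exact: cvg_id].
Qed.

(** The point where the ray leaves [C] for good: the supremum of the parameters
    with value in [C] is attained because [C] is closed, and a value in the
    interior would allow a larger parameter. *)
Lemma boundary_on_ray C x u : compact C -> C x -> u <> 0 ->
  exists t, [/\ 0 <= t, C (x + t *: u) & boundary C (x + t *: u)].
Proof.
move=> cC Cx u0; pose p t := x + t *: u.
have up : 0 < `|u| by rewrite normr_gt0; apply/eqP.
have [M MC] : exists M, forall y, C y -> `|y| <= M.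
  have PF : ProperFilter (globally C) := globally_properfilter Cx.
  have /ex_bound[M h] := compact_bounded cC.
  by exists M; exact: h.
pose T := [set t | 0 <= t /\ C (p t)].
have T0 : T 0 by split=> //; rewrite /p scale0r addr0.
have Tub : has_ubound T.
  exists ((M + `|x|) / `|u|) => t [t0 /MC h].
  rewrite ler_pdivlMr // -(ger0_norm t0) -normrZ.
  have -> : t *: u = p t - x by rewrite /p addrC addKr.
  by rewrite (le_trans (ler_normB _ _)) // lerD2r.
pose s := sup T.
have pc : continuous p := @ray_continuous x u.
have Cs : C (p s).
  apply: (compact_closed _ cC); first exact: norm_hausdorff.
  move=> B /(pc s) Bs.
  have [|t [[_ Ct] Bt]] := closure_sup _ Tub Bs; first by exists 0.
  by exists (p t).
have s0 : 0 <= s by exact: ub_le_sup.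
exists s; split=> //; split; first exact: subset_closure.
move=> /(pc s) /nbhs_ballP [e e0 he].
have : T (s + e / 2).
  split; first by rewrite addr_ge0 // divr_ge0 // ltW.
  apply: he; rewrite /ball /= opprD addNKr normrN gtr0_norm ?divr_gt0 //.
  by rewrite ltr_pdivrMr // ltr_pMr // ltr1n.
by move=> /(ub_le_sup Tub); rewrite gerDl leNgt divr_gt0.
Qed.

Lemma dist_boundary_ge0 C x : 0 <= dist_boundary C x.
Proof.
rewrite /dist_boundary; have [->|/set0P A0] := eqVneq [set enorm (y - x) | y in boundary C] set0.
  by rewrite inf0.
by apply: lb_le_inf => // _ [y _ <-]; exact: enorm_ge0.
Qed.

Lemma dist_boundary_le C x y : boundary C y -> dist_boundary C x <= enorm (y - x).
Proof.
move=> By; apply: ge_inf; last by exists y.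
by exists 0 => _ [z _ <-]; exact: enorm_ge0.
Qed.

End Boundary.

(** * Gradients of strongly convex functions *)

Section Gradients.
Context {R : realType} {n : nat}.
Implicit Types (x xs : 'rV[R]_n) (C : set 'rV[R]_n) (f : 'rV[R]_n -> R).

(** Moving from [x] along the gradient, strong convexity makes the gradient grow
    at rate at least [sigma]; the bound [L] still holds where the ray meets the
    boundary of [C], at a distance at least [dist_boundary C x]. *)
Lemma gradient_le_dist_boundary (sigma L : R) C f x :
  0 < sigma -> compact C -> C x -> gradient f x <> 0 ->
  strongly_convex_bounded sigma L C f ->
  enorm (gradient f x) <= L - sigma * dist_boundary C x.
Proof.
move=> s0 cC Cx g0 [[_ fsc] fL]; set g := gradient f x.
have [t [t0 Cy By]] := boundary_on_ray cC Cx g0.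
rewrite -/g in Cy By; set y := x + t *: g in Cy By.
have gp := enorm_gt0 g0; rewrite -/g in gp.
have yx : y - x = t *: g by rewrite /y addrC addKr.
have d := dist_boundary_le x By; rewrite yx enormZ ger0_norm // in d.
rewrite lerBrDr; apply: (@le_trans _ _ (enorm g + sigma * (t * enorm g))).
  by rewrite lerD2l ler_pM2l.
apply: le_trans (fL _ Cy).
have := fsc y x; rewrite yx enormZ ger0_norm // !dotZr dotBl -/g -sqr_enorm => h.
have := dot_le_enorm (gradient f y) g => k.
(* Strong convexity between [x] and [y] says something only when they differ;
   for [t = 0] the bound [L] holds at [x] itself. *)
have [tp|] := ltP 0 t; last first.
  move=> tn; have t00 : t = 0 by apply/eqP; rewrite eq_le tn.
  by rewrite t00 mul0r mulr0 addr0 /y t00 scale0r addr0.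
rewrite -(ler_pM2r gp); apply: le_trans k.
by rewrite -(ler_pM2l tp); nra.
Qed.

Definition halfsq (sigma : R) xs : 'rV[R]_n -> R :=
  fun x => sigma / 2 * dot (x - xs) (x - xs).

Lemma halfsq_differentiable sigma xs x : differentiable (halfsq sigma xs) x.
Proof.
have -> : halfsq sigma xs =
    (sigma / 2) *: \sum_(i < n) ((fun y : 'rV[R]_n => y 0 i) - cst (xs 0 i)) ^+ 2.
  apply/funext => y; rewrite /halfsq /dot fctE; congr (_ * _).
  by rewrite fct_sumE; apply: eq_bigr => i _; rewrite !mxE -expr2.
apply: differentiableZ; apply: differentiable_sum => i; apply: differentiableX.
by apply: differentiableB; [exact: differentiable_coord|exact: differentiable_cst].
Qed.

Lemma gradient_halfsq sigma xs x : gradient (halfsq sigma xs) x = sigma *: (x - xs).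
Proof.
apply/rowP => j; rewrite !mxE; apply: cvg_lim => //=.
set v := delta_mx 0 j.
have dv z : dot v z = z 0 j.
  rewrite /dot (bigD1 j) //= big1 ?addr0 => [|i ij]; rewrite !mxE !eqxx /=.
    by rewrite mul1r.
  by rewrite (negbTE ij) mul0r.
(* The difference quotient in the direction [v] is affine in [h]. *)
have : (fun h : R => sigma * (x 0 j - xs 0 j) + h * (sigma / 2)) h @[h --> 0^']
    --> sigma * (x 0 j - xs 0 j) + 0 * (sigma / 2).
  apply: cvgD; first exact: cvg_cst.
  by apply: cvgMr_tmp; exact: (@cvg_within _ (nbhs (0 : R))).
rewrite mul0r addr0; apply: cvg_trans; apply: near_eq_cvg.
near=> h.
have h0 : h != 0 by near: h; exact: nbhs_dnbhs_neq.
rewrite /halfsq /= -addrA !(dotDl, dotDr, dotZl, dotZr).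
rewrite !(dotC _ v) !dv !mxE !eqxx /= /GRing.scale /=.
by field.
Unshelve. all: by end_near. Qed.

Lemma halfsq_strongly_convex sigma xs : strongly_convex sigma (halfsq sigma xs).
Proof.
split=> [x|x y]; first exact: halfsq_differentiable.
by rewrite !gradient_halfsq -scalerBr opprB addrA subrK dotZl sqr_enorm.
Qed.

End Gradients.

Section StrongConvexity.
Context {R : realType} {n : nat}.
Context (sigma : R) (f : 'rV[R]_n -> R) (xs : 'rV[R]_n).
Context (sigma0 : 0 < sigma) (fsc : strongly_convex sigma f).
Context (fxs : gradient f xs = 0).

Lemma strong_convexity_at_zero x :
  sigma * enorm (x - xs) ^+ 2 <= dot (gradient f x) (x - xs).
Proof. by have [_ /(_ x xs)] := fsc; rewrite fxs subr0. Qed.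

Lemma gradient_lower_bound x : sigma * enorm (x - xs) <= enorm (gradient f x).
Proof.
have [->|/eqP d0] := eqVneq (x - xs) 0.
  by rewrite /enorm -{1 2}[0](scale0r (0 : 'rV[R]_n)) dotZl mul0r sqrtr0 mulr0 sqrtr_ge0.
rewrite -(ler_pM2r (enorm_gt0 d0)); apply: le_trans (dot_le_enorm _ _).
by rewrite -mulrA -expr2; exact: strong_convexity_at_zero.
Qed.

Lemma gradient_neq0 x : x <> xs -> gradient f x <> 0.
Proof.
move=> xxs gx0; have := strong_convexity_at_zero x.
have d0 : 0 < enorm (x - xs) by apply: enorm_gt0 => /subr0_eq.
rewrite gx0 -[0](scale0r (0 : 'rV[R]_n)) dotZl mul0r leNgt.
by rewrite mulr_gt0 ?exprn_gt0.
Qed.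

(** [strong_convexity_at_zero] bounds the cosine of the angle below by [sigma]
    times the distance to [xs], divided by the norm of the gradient. *)
Lemma angle_gradient_le (l : R) x : x <> xs -> enorm (gradient f x) <= l ->
  angle (gradient f x) (x - xs) <= phi_tilde sigma xs x l.
Proof.
move=> xxs gl; have gn := gradient_neq0 xxs.
have d0 : 0 < enorm (x - xs) by apply: enorm_gt0 => /subr0_eq.
have gp := enorm_gt0 gn; have lp : 0 < l by exact: lt_le_trans gl.
have /andP[_ c1] := cos_arg_itv gn (fun h => xxs (subr0_eq h)).
apply: acos_le c1.
  by rewrite (@le_trans _ _ 0) // ?oppr_le0 // mulr_ge0 ?divr_ge0 ?ltW.
rewrite ler_pdivlMr ?mulr_gt0 //.
apply: le_trans (strong_convexity_at_zero x).
rewrite (_ : _ * (_ * _) = sigma * enorm (x - xs) ^+ 2 * (enorm (gradient f x) / l)).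
  rewrite ler_piMr ?ler_pdivrMr ?mul1r ?mulr_ge0 ?sqr_ge0 //; exact: ltW.
by field; rewrite gt_eqF.
Qed.

End StrongConvexity.

(** * Comparison of the sets *)

Section Sets.
Context {R : realType} {n : nat}.
Implicit Types (x : 'rV[R]_n) (C : set 'rV[R]_n).

(** In the triangle with vertices [x1], [x2], [x] the angle [alpha] at [x2] is an
    exterior one, so [psi] is the angle at [x1] plus the interior angle at [x2],
    that is, [pi] minus the interior angle at [x]. In terms of the edges
    [x - x1] and [x2 - x], whose sum is [x2 - x1], this is [angle_cone]. *)
Lemma psi_le x1 x2 x : x1 <> x2 -> x <> x1 -> x <> x2 ->
  psi x1 x2 x <= angle (x - x1) (x2 - x).
Proof.
move=> x12 xx1 xx2.
have a0 : x - x1 <> 0 by move=> /subr0_eq.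
have b0 : x2 - x <> 0 by move=> /subr0_eq /esym.
have e : x - x1 + (x2 - x) = x2 - x1 by rewrite addrC addrA subrK.
have c0 : x2 - x1 <> 0 by move=> /subr0_eq /esym.
rewrite /psi /alpha -(opprB x2 x) angleNl //.
rewrite (_ : pi - _ = angle (x - x1) (x2 - x1) + angle (x2 - x1) (x2 - x)).
  by rewrite -e; apply: angle_cone => //; rewrite e.
by rewrite (angleC (x2 - x1) (x2 - x)); ring.
Qed.

Lemma phi_tilde_le sigma (l l' : R) xs x : 0 < sigma -> 0 < l -> l <= l' ->
  enorm (x - xs) <= 1 / sigma * l ->
  phi_tilde sigma xs x l <= phi_tilde sigma xs x l'.
Proof.
move=> s0 l0 ll' h; have l'0 := lt_le_trans l0 ll'.
apply: acos_le.
- rewrite (@le_trans _ _ 0) ?oppr_le0 // mulr_ge0 ?enorm_ge0 //.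
  by rewrite divr_ge0 ?ltW.
- by rewrite ler_wpM2r ?enorm_ge0 // ler_pM2l // lef_pV2.
- rewrite mulrAC ler_pdivrMr // mul1r mulrC -ler_pdivlMr //.
  by rewrite mulrC -[_^-1]mul1r.
Qed.

Lemma gradient_le_Ltilde (sigma1 sigma2 sigma L : R) C f x :
  0 < sigma -> Num.min sigma1 sigma2 <= sigma ->
  compact C -> C x -> gradient f x <> 0 ->
  strongly_convex_bounded sigma L C f ->
  enorm (gradient f x) <= Ltilde sigma1 sigma2 L C x.
Proof.
move=> s0 ms cC Cx g0 fL.
apply: le_trans (gradient_le_dist_boundary s0 cC Cx g0 fL) _.
by rewrite lerD2l lerN2 ler_wpM2r ?dist_boundary_ge0.
Qed.

End Sets.

Theorem lemma10 (R : realType) (n : nat) (hn : (1 <= n)%N)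
    (sigma1 sigma2 L : R) (hsigma1 : 0 < sigma1) (hsigma2 : 0 < sigma2)
    (hL : 0 < L) (x1 x2 : 'rV[R]_n) (hx : x1 <> x2)
    (C : set 'rV[R]_n) (hCcompact : compact C)
    (hCconvex : convex_set (C : set (convex_lmodType 'rV[R]_n)))
    (hx1 : C x1) (hx2 : C x2) :
  [/\ N_set sigma1 sigma2 L C x1 x2 `<=` N_hat sigma1 sigma2 L C x1 x2,
      N_hat sigma1 sigma2 L C x1 x2 `<=` I_set sigma1 sigma2 L C x1 x2,
      I_set sigma1 sigma2 L C x1 x2 =
        I_single sigma1 sigma2 L C sigma1 x1 `&`
        I_single sigma1 sigma2 L C sigma2 x2 &
      N_hat sigma1 sigma2 L C x1 x2 `<=` M_hat sigma1 sigma2 L x1 x2].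
Proof.
split.
- move=> x [Cx [f1 [f2 [f1L f2L g1 g2 g12]]]]; split=> //=.
  have [f1s _] := f1L; have [f2s _] := f2L.
  (* A common zero of the two gradients would make [x1] and [x2] coincide, as
     each gradient vanishes at one point only. *)
  have n1 : x <> x1.
    move=> xx1; apply: (gradient_neq0 (x := x) hsigma2 f2s g2).
      by rewrite xx1.
    by rewrite -[LHS]opprK -g12 xx1 g1 oppr0.
  have n2 : x <> x2.
    move=> xx2; apply: (gradient_neq0 (x := x) hsigma1 f1s g1) => //.
    by rewrite g12 xx2 g2 oppr0.
  have gx1 := gradient_neq0 hsigma1 f1s g1 n1.
  have gx2 := gradient_neq0 hsigma2 f2s g2 n2.
  have l1 : enorm (gradient f1 x) <= Ltilde sigma1 sigma2 L C x.
    by apply: gradient_le_Ltilde f1L => //; rewrite ge_min lexx.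
  have l2 : enorm (gradient f2 x) <= Ltilde sigma1 sigma2 L C x.
    by apply: gradient_le_Ltilde f2L => //; rewrite ge_min lexx orbT.
  split=> //.
  + apply: le_trans (psi_le hx n1 n2) _.
    apply: (le_trans (@angle_triangle _ _ _ _ (gradient f1 x) _ _ _)) => //.
    * by move=> /subr0_eq.
    * by move=> /subr0_eq /esym.
    apply: lerD; first by rewrite angleC; exact: angle_gradient_le.
    by rewrite g12 -(opprB x x2) angleNN; exact: angle_gradient_le.
  + rewrite div1r mulrC ler_pdivlMr // mulrC.
    exact: le_trans (gradient_lower_bound f1s g1 x) l1.
  + rewrite div1r mulrC ler_pdivlMr // mulrC.
    exact: le_trans (gradient_lower_bound f2s g2 x) l2.
- move=> x [Cx [_ _ _ b1 b2]]; split=> //.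
  exists (halfsq sigma1 x1), (halfsq sigma2 x2).
  rewrite !gradient_halfsq !subrr !scaler0 !enormZ !gtr0_norm //; split=> //.
  + by split; exact: halfsq_strongly_convex.
  + by move: b1; rewrite div1r mulrC ler_pdivlMr // mulrC.
  + by move: b2; rewrite div1r mulrC ler_pdivlMr // mulrC.
- apply/seteqP; split=> x.
    move=> [Cx [f1 [f2 [[? ?] ? ? ? ?]]]].
    by split; split=> //; [exists f1 | exists f2].
  move=> [[Cx [f1 [? ? ?]]] [_ [f2 [? ? ?]]]].
  by split=> //; exists f1, f2.
- move=> x [_ /= [n1 n2 p b1 b2]].
  have lL : Ltilde sigma1 sigma2 L C x <= L.
    rewrite gerBl mulr_ge0 ?dist_boundary_ge0 //.
    by rewrite le_min !ltW.
  have l0 : 0 < Ltilde sigma1 sigma2 L C x.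
    have d0 : 0 < enorm (x - x1) by apply: enorm_gt0 => /subr0_eq.
    by have := lt_le_trans d0 b1; rewrite div1r pmulr_rgt0 // invr_gt0.
  split=> //.
  + by apply: le_trans p _; apply: lerD; exact: phi_tilde_le.
  + by apply: le_trans b1 _; rewrite div1r mulrC ler_pM2r ?invr_gt0.
  + by apply: le_trans b2 _; rewrite div1r mulrC ler_pM2r ?invr_gt0.
Qed.
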